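(* Let $\bar x\in\mathbb{R}^n$ be a feasible point of the problem (MPVC). The following are equivalent. (a) $\bar x$ is linearized B-stationary. (b) $\bar x$ is $A_\alpha$-stationary for all $\alpha\in\{0,1\}^p$. (c) $\bar x$ is $P_d$-stationary for all $d\in[0,1]^p$. (d) $\bar x$ is $P_\alpha$-stationary for all $\alpha\in\{0,1\}^p$.
   Context: Let $f:\mathbb{R}^n\to\mathbb{R}$, $g:\mathbb{R}^n\to\mathbb{R}^l$, $h:\mathbb{R}^n\to\mathbb{R}^m$, $G,H:\mathbb{R}^n\to\mathbb{R}^p$ be differentiable functions. The mathematical program with vanishing constraints (MPVC) is: minimize $f(x)$ over $x\in\mathbb{R}^n$ subject to $g(x)\le 0$, $h(x)=0$, and $H_i(x)\ge 0$, $G_i(x)H_i(x)\le 0$ for all $i\in\{1,\dots,p\}$. Index sets: $I^l=\{1,\dots,l\}$, $I^m=\{1,\dots,m\}$, $I^p=\{1,\dots,p\}$, $I^g(x)=\{i\in I^l: g_i(x)=0\}$, and, as subsets of $I^p$, $I^{+0}(x)=\{G_i(x)>0, H_i(x)=0\}$, $I^{0+}(x)=\{G_i(x)=0, H_i(x)>0\}$, $I^{-0}(x)=\{G_i(x)<0, H_i(x)=0\}$, $I^{-+}(x)=\{G_i(x)<0, H_i(x)>0\}$, $I^{00}(x)=\{G_i(x)=0, H_i(x)=0\}$; for $\alpha\in\{0,1\}^p$ and $c\in\{0,1\}$, $I^{00}_{\alpha=c}(x)=\{i\in I^{00}(x): \alpha_i=c\}$. Weak stationarity: multipliers $\bar\lambda\in\mathbb{R}^l$,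 $\bar\eta\in\mathbb{R}^m$, $\bar\mu,\bar\nu\in\mathbb{R}^p$ satisfy the system of weak stationarity at a feasible point $\bar x$ of (MPVC) if $$\nabla f(\bar x)+\sum_{i\in I^l}\bar\lambda_i\nabla g_i(\bar x)+\sum_{i\in I^m}\bar\eta_i\nabla h_i(\bar x)+\sum_{i\in I^p}\bar\mu_i\nabla G_i(\bar x)-\sum_{i\in I^p}\bar\nu_i\nabla H_i(\bar x)=0,$$ $\bar\lambda_i\ge 0$ for $i\in I^g(\bar x)$, $\bar\lambda_i=0$ for $i\in I^l\setminus I^g(\bar x)$, $\bar\mu_i=0$ for $i\in I^{+0}(\bar x)\cup I^{-0}(\bar x)\cup I^{-+}(\bar x)$, $\bar\mu_i\ge 0$ for $i\in I^{0+}(\bar x)\cup I^{00}(\bar x)$, $\bar\nu_i=0$ for $i\in I^{0+}(\bar x)\cup I^{-+}(\bar x)$, $\bar\nu_i\ge 0$ for $i\in I^{-0}(\bar x)$. For $\alpha\in\{0,1\}^p$ and $d\in[0,1]^p$, a feasible point $\bar x$ of (MPVC) is called - $A_\alpha$-stationary if there exist multipliers satisfying the system of weak stationarity together with $\bar\mu_i=0$ for all $i\in I^{00}_{\alpha=0}(\bar x)$ and $\bar\nu_i\ge 0$ for all $i\in I^{00}_{\alpha=1}(\bar x)$; - $P_\alpha$-stationary if there exist multipliers satisfying the system of weak stationarity together with $\bar\mu_i=0$ for all $i\in I^{00}_{\alpha=0}(\bar x)$ and $(\bar\mu_i=0\wedge\bar\nu_i\ge 0)\vee\bar\nu_i=0$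 for all $i\in I^{00}_{\alpha=1}(\bar x)$; - $P_d$-stationary if there exist multipliers satisfying the system of weak stationarity together with $(\bar\mu_i=0\wedge\bar\nu_i\ge 0)\vee(1-d_i)\bar\mu_i=-d_i\bar\nu_i$ for all $i\in I^{00}(\bar x)$; - linearized B-stationary if $-\nabla f(\bar x)\in\mathcal{T}_{\rm MPVC}^{\rm lin}(\bar x)^\circ$, where $C^\circ=\{d\in\mathbb{R}^n: d^\top y\le 0\ \forall y\in C\}$ is the polar cone of $C\subset\mathbb{R}^n$ and $\mathcal{T}_{\rm MPVC}^{\rm lin}(\bar x)$ is the set of all $d\in\mathbb{R}^n$ with $\nabla g_i(\bar x)^\top d\le 0$ for $i\in I^g(\bar x)$; $\nabla h_i(\bar x)^\top d=0$ for $i\in I^m$; $\nabla G_i(\bar x)^\top d\le 0$ for $i\in I^{0+}(\bar x)$; $\nabla H_i(\bar x)^\top d=0$ for $i\in I^{+0}(\bar x)$; $\nabla H_i(\bar x)^\top d\ge 0$ for $i\in I^{00}(\bar x)\cup I^{-0}(\bar x)$; $(\nabla G_i(\bar x)^\top d)(\nabla H_i(\bar x)^\top d)\le 0$ for $i\in I^{00}(\bar x)$. *)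

(* Defs.v *)
From HB Require Import structures.
From mathcomp Require Import all_boot all_order all_algebra.
From mathcomp Require Import all_classical all_reals all_analysis.
Set Implicit Arguments.
Unset Strict Implicit.
Unset Printing Implicit Defensive.
Import Order.TTheory GRing.Theory Num.Theory.
Import numFieldNormedType.Exports.
Local Open Scope ring_scope.

(* R^n is the space of row vectors, so u^T v reads u *m v^T. *)
Definition dot (R : realType) (n : nat) (u v : 'rV[R]_n) : R :=
  (u *m v^T) 0 0.

(* Partial derivatives of F at x; the gradient when F is differentiable at x. *)
Definition gradient (R : realType) (n : nat) (F : 'rV[R]_n -> R)
  (x : 'rV[R]_n) : 'rV[R]_n := \row_j 'D_(delta_mx 0 j) F x.

Definition component (R : realType) (n k : nat) (F : 'rV[R]_n -> 'rV[R]_k)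
  (i : 'I_k) : 'rV[R]_n -> R := fun x => F x 0 i.

Definition polar (R : realType) (n : nat) (C : set 'rV[R]_n) :
  set 'rV[R]_n := [set d | forall y, C y -> dot d y <= 0]%classic.

(* Minimize f x subject to g x <= 0, h x = 0, H_i x >= 0, G_i x * H_i x <= 0. *)
Record mpvc (R : realType) (n l m p : nat) := Mpvc {
  mpvc_f : 'rV[R]_n -> R;
  mpvc_g : 'rV[R]_n -> 'rV[R]_l;
  mpvc_h : 'rV[R]_n -> 'rV[R]_m;
  mpvc_G : 'rV[R]_n -> 'rV[R]_p;
  mpvc_H : 'rV[R]_n -> 'rV[R]_p
}.

Definition feasible (R : realType) (n l m p : nat) (P : mpvc R n l m p)
  (x : 'rV[R]_n) : Prop :=
  [/\ forall i, component (mpvc_g P) i x <= 0,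
      forall i, component (mpvc_h P) i x = 0,
      forall i, 0 <= component (mpvc_H P) i x
    & forall i, component (mpvc_G P) i x * component (mpvc_H P) i x <= 0].

Definition Ig (R : realType) (n l m p : nat) (P : mpvc R n l m p)
  (x : 'rV[R]_n) : {set 'I_l} :=
  [set i | component (mpvc_g P) i x == 0].

(* In the names of the subsets of 'I_p, the first sign is that of G_i and the
   second that of H_i ("p" for +, "m" for -). *)
Definition Ip0 (R : realType) (n l m p : nat) (P : mpvc R n l m p)
  (x : 'rV[R]_n) : {set 'I_p} :=
  [set i | (0 < component (mpvc_G P) i x) && (component (mpvc_H P) i x == 0)].

Definition I0p (R : realType) (n l m p : nat) (P : mpvc R n l m p)
  (x : 'rV[R]_n) : {set 'I_p} :=
  [set i | (component (mpvc_G P) i x == 0) && (0 < component (mpvc_H P) i x)].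

Definition Im0 (R : realType) (n l m p : nat) (P : mpvc R n l m p)
  (x : 'rV[R]_n) : {set 'I_p} :=
  [set i | (component (mpvc_G P) i x < 0) && (component (mpvc_H P) i x == 0)].

Definition Imp (R : realType) (n l m p : nat) (P : mpvc R n l m p)
  (x : 'rV[R]_n) : {set 'I_p} :=
  [set i | (component (mpvc_G P) i x < 0) && (0 < component (mpvc_H P) i x)].

Definition I00 (R : realType) (n l m p : nat) (P : mpvc R n l m p)
  (x : 'rV[R]_n) : {set 'I_p} :=
  [set i | (component (mpvc_G P) i x == 0) && (component (mpvc_H P) i x == 0)].

(* {0,1} is bool. *)
Definition I00_eq (R : realType) (n l m p : nat) (P : mpvc R n l m p)
  (x : 'rV[R]_n) (alpha : {ffun 'I_p -> bool}) (c : bool) : {set 'I_p} :=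
  [set i in I00 P x | alpha i == c].

Definition weak_system (R : realType) (n l m p : nat) (P : mpvc R n l m p)
  (x : 'rV[R]_n) (lambda : 'rV[R]_l) (eta : 'rV[R]_m) (mu nu : 'rV[R]_p) :
  Prop :=
  gradient (mpvc_f P) x
    + \sum_i lambda 0 i *: gradient (component (mpvc_g P) i) x
    + \sum_i eta 0 i *: gradient (component (mpvc_h P) i) x
    + \sum_i mu 0 i *: gradient (component (mpvc_G P) i) x
    - \sum_i nu 0 i *: gradient (component (mpvc_H P) i) x = 0 /\
  [/\ forall i, i \in Ig P x -> 0 <= lambda 0 i,
      forall i, i \in ~: Ig P x -> lambda 0 i = 0,
      forall i, i \in Ip0 P x :|: Im0 P x :|: Imp P x -> mu 0 i = 0
    & forall i, i \in I0p P x :|: I00 P x -> 0 <= mu 0 i] /\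
  (forall i, i \in I0p P x :|: Imp P x -> nu 0 i = 0) /\
  (forall i, i \in Im0 P x -> 0 <= nu 0 i).

Definition A_stationary (R : realType) (n l m p : nat) (P : mpvc R n l m p)
  (alpha : {ffun 'I_p -> bool}) (x : 'rV[R]_n) : Prop :=
  feasible P x /\
  exists (lambda : 'rV[R]_l) (eta : 'rV[R]_m) (mu nu : 'rV[R]_p),
    [/\ weak_system P x lambda eta mu nu,
        forall i, i \in I00_eq P x alpha false -> mu 0 i = 0
      & forall i, i \in I00_eq P x alpha true -> 0 <= nu 0 i].

Definition P_stationary (R : realType) (n l m p : nat) (P : mpvc R n l m p)
  (alpha : {ffun 'I_p -> bool}) (x : 'rV[R]_n) : Prop :=
  feasible P x /\
  exists (lambda : 'rV[R]_l) (eta : 'rV[R]_m) (mu nu : 'rV[R]_p),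
    [/\ weak_system P x lambda eta mu nu,
        forall i, i \in I00_eq P x alpha false -> mu 0 i = 0
      & forall i, i \in I00_eq P x alpha true ->
          (mu 0 i = 0 /\ 0 <= nu 0 i) \/ nu 0 i = 0].

Definition Pd_stationary (R : realType) (n l m p : nat) (P : mpvc R n l m p)
  (d : 'rV[R]_p) (x : 'rV[R]_n) : Prop :=
  feasible P x /\
  exists (lambda : 'rV[R]_l) (eta : 'rV[R]_m) (mu nu : 'rV[R]_p),
    weak_system P x lambda eta mu nu /\
    forall i, i \in I00 P x ->
      (mu 0 i = 0 /\ 0 <= nu 0 i) \/
      (1 - d 0 i) * mu 0 i = - d 0 i * nu 0 i.

Definition lin_cone (R : realType) (n l m p : nat) (P : mpvc R n l m p)
  (x : 'rV[R]_n) : set 'rV[R]_n :=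
  [set d |
    [/\ forall i, i \in Ig P x -> dot (gradient (component (mpvc_g P) i) x) d <= 0,
        forall i, dot (gradient (component (mpvc_h P) i) x) d = 0
      & forall i, i \in I0p P x -> dot (gradient (component (mpvc_G P) i) x) d <= 0]
    /\
    [/\ forall i, i \in Ip0 P x -> dot (gradient (component (mpvc_H P) i) x) d = 0,
        forall i, i \in I00 P x :|: Im0 P x ->
          0 <= dot (gradient (component (mpvc_H P) i) x) d
      & forall i, i \in I00 P x ->
          dot (gradient (component (mpvc_G P) i) x) d
          * dot (gradient (component (mpvc_H P) i) x) d <= 0]]%classic.

Definition linB_stationary (R : realType) (n l m p : nat)
  (P : mpvc R n l m p) (x : 'rV[R]_n) : Prop :=
  feasible P x /\ polar (lin_cone P x) (- gradient (mpvc_f P) x).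

(* Main.v *)
(* The linearized cone is the union over alpha of polyhedral cones, and Farkas'
   lemma on each of them turns (a) into (b). For (b) => (c), multipliers at a fixed
   point form a convex set; interpolating multilinearly on the cube [0,1]^p between
   the multipliers given at its vertices alpha, the i-th pair (mu_i, nu_i) stays in
   {mu_i = 0} on the face t_i = 0 and in {mu_i, nu_i >= 0} on the face t_i = 1. The
   set of pairs required by P_d-stationarity separates these two, so the
   Poincare-Miranda theorem gives a point of the cube where all p pairs belong to it.
   That theorem follows by compactness from a discrete one: on a fine grid, the mod 2
   cup product of the coboundaries of the sign functions sums to 1, hence in some
   cell every function changes sign. *)
Require Import Defs.
From HB Require Import structures.
From mathcomp Require Import all_boot all_order all_algebra.
From mathcomp Require Import all_classical all_reals all_analysis.
Import Order.TTheory GRing.Theory Num.Theory.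
Import numFieldNormedType.Exports.
Local Open Scope ring_scope.

(** * Mod 2 cubical cochains and their cup product *)

Lemma F2_addrr (x : 'F_2) : x + x = 0.
Proof. by apply: addrr_pchar2; rewrite pchar_Fp. Qed.

(* Cubical cochains mod 2: [b z I] is the value on the cube with base vertex [z]
   and edge directions [e i] for [i] in [I]. *)
Definition coboundary {V : zmodType} {q : nat} (e : 'I_q -> V)
    (b : V -> {set 'I_q} -> 'F_2) (z : V) (I : {set 'I_q}) : 'F_2 :=
  \sum_(i in I) (b (z + e i) (I :\ i) + b z (I :\ i)).

(* Cup product of the coboundaries of the vertex functions [c k], [k] in [s]. *)
Fixpoint cup {V : zmodType} {q : nat} (e : 'I_q -> V) (c : 'I_q -> V -> 'F_2)
    (s : seq 'I_q) (z : V) (I : {set 'I_q}) : 'F_2 :=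
  if s is k :: s' then
    \sum_(i in I) (c k (z + e i) + c k z) * cup e c s' (z + e i) (I :\ i)
  else (I == finset.set0)%:R.

(** Each unordered pair of indices contributes the same term twice, which is zero in ['F_2]. *)
Lemma sum_sym_offdiag_F2 (q : nat) (I : {set 'I_q}) (F : 'I_q -> 'I_q -> 'F_2) :
  (forall i j, F i j = F j i) ->
  \sum_(i in I) \sum_(j in I :\ i) F i j = 0.
Proof.
move=> Fsym.
have split_lt (i : 'I_q) : \sum_(j in I :\ i) F i j =
    \sum_(j in I | (i < j)%N) F i j + \sum_(j in I | (j < i)%N) F i j.
  rewrite (bigID (fun j : 'I_q => i < j)%N) /=; congr (_ + _).
    by apply: eq_bigl => j; rewrite !inE -val_eqE /= neq_ltn; case: ltngtP; rewrite ?andbT ?andbF.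
  by apply: eq_bigl => j; rewrite !inE -val_eqE /= neq_ltn; case: ltngtP; rewrite ?andbT ?andbF.
under eq_bigr do rewrite split_lt.
rewrite big_split /=.
rewrite [X in _ + X](exchange_big_dep (fun j => j \in I)) /=; last by move=> i j _ /andP[].
rewrite -[RHS](F2_addrr (\sum_(i in I) \sum_(j in I | (i < j)%N) F i j)); congr (_ + _).
apply: eq_bigr => i iI; apply: eq_big => [j|j _]; last exact: Fsym.
by rewrite iI /=.
Qed.

(** Two directions can be removed in either order, so the double sum is symmetric in them and
    cancels in pairs. *)
Lemma coboundaryK {V : zmodType} {q : nat} (e : 'I_q -> V) b z I :
  coboundary e (coboundary e b) z I = 0.
Proof.
rewrite /coboundary; under eq_bigr do rewrite -big_split.
apply: sum_sym_offdiag_F2 => i j.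
have -> : I :\ j :\ i = I :\ i :\ j by apply/finset.setP => k; rewrite !inE andbCA.
by rewrite (addrAC z (e j)) /= addrACA.
Qed.

(** Discrete Leibniz rule: the term carrying the coboundary of [cup e c s] vanishes, so only the
    differences of [c k] remain. *)
Lemma cup_closed_cons {V : zmodType} {q : nat} (e : 'I_q -> V) c s :
  (forall z I, coboundary e (cup e c s) z I = 0) ->
  forall k z I, cup e c (k :: s) z I =
    coboundary e (fun y J => c k y * cup e c s y J) z I.
Proof.
move=> closed k z I; transitivity (cup e c (k :: s) z I + c k z * coboundary e (cup e c s) z I).
  by rewrite closed mulr0 addr0.
rewrite /= /coboundary mulr_sumr -big_split; apply: eq_bigr => i _ /=.
by rewrite mulrDl mulrDr -addrA [X in _ + X]addrA F2_addrr add0r.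
Qed.

Lemma cup_closed {V : zmodType} {q : nat} (e : 'I_q -> V) c s z I :
  coboundary e (cup e c s) z I = 0.
Proof.
elim: s z I => [|k s IH] z I; first by apply: big1 => i _; rewrite F2_addrr.
rewrite -[RHS](coboundaryK e (fun y J => c k y * cup e c s y J) z I).
by apply: eq_bigr => i _; rewrite !(cup_closed_cons _ _ _ IH).
Qed.

(** Expanding [cup] gives products along edge paths of the cube, and each product contains a
    difference of [c i] between two vertices of that cube. *)
Lemma cup_const {V : zmodType} {q : nat} (e : 'I_q -> V) c (s : seq 'I_q) i a z (I : {set 'I_q}) :
  i \in s -> (forall J : {set 'I_q}, J \subset I -> c i (z + \sum_(j in J) e j) = a) ->
  cup e c s z I = 0.
Proof.
elim: s z I => // k s IH z I; rewrite inE => iks ca /=; apply: big1 => j jI.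
have [ik|ik] := eqVneq i k.
  have := ca finset.set0 (finset.sub0set _).
  have := ca [set j]%SET; rewrite finset.sub1set jI => /(_ isT).
  by rewrite finset.big_set1 finset.big_set0 addr0 -ik => -> ->; rewrite F2_addrr mul0r.
rewrite (IH (z + e j) (I :\ j)) ?mulr0//; first by move: iks; rewrite (negbTE ik).
move=> J /subsetD1P[JI jJ]; rewrite -addrA -finset.big_setU1//.
by apply: ca; rewrite finset.subUset finset.sub1set jI.
Qed.

(** * Discrete Poincare-Miranda theorem on a grid *)

(* ['I_N.+2] is used as a cyclic group, so that translations are bijections; the
   cubes considered below never wrap around. *)
Definition grid_step {q N : nat} (j : 'I_q) : {ffun 'I_q -> 'I_N.+2} := [ffun k => (k == j)%:R].

Lemma sum_grid_stepE {q N : nat} (J : {set 'I_q}) k :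
  (\sum_(j in J) grid_step j : {ffun 'I_q -> 'I_N.+2}) k = (k \in J)%:R.
Proof.
rewrite sum_ffunE; case: (boolP (k \in J)) => kJ.
  rewrite (finset.big_setD1 k)//= ffunE eqxx big1 ?addr0// => j.
  by rewrite !inE ffunE eq_sym => /andP[/negbTE ->].
by apply: big1 => j jJ; rewrite ffunE; case: eqP kJ jJ => // -> /negbTE ->.
Qed.

(** Translation by [grid_step i] carries the layers before the last onto those after the first;
    interior layers then occur twice and cancel mod 2. *)
Lemma sum_telescope {q N : nat} (i : 'I_q) (B : pred {ffun 'I_q -> 'I_N.+2})
    (F : {ffun 'I_q -> 'I_N.+2} -> 'F_2) :
  (forall z, B (z + grid_step i) = B z) ->
  \sum_(z | B z && (z i != ord_max)) (F (z + grid_step i) + F z) =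
  \sum_(z | B z && (z i == ord_max)) F z + \sum_(z | B z && (z i == 0)) F z.
Proof.
move=> Bi; rewrite big_split /=.
have -> : \sum_(z | B z && (z i != ord_max)) F (z + grid_step i) =
          \sum_(z | B z && (z i != 0)) F z.
  rewrite [RHS](reindex_inj (addIr (grid_step i))) /=; apply: eq_bigl => z.
  (* In the cyclic group [- 1] is [ord_max], so the shifted coordinate is zero exactly on the last
     layer. *)
  rewrite Bi; congr (_ && ~~ _); rewrite !ffunE eqxx addr_eq0.
  congr (_ == _); apply/val_inj => /=.
  by rewrite [in RHS]modn_small// modn_small subSS subn0.
have splitB (P : pred _) : \sum_(z | B z && ~~ P z) F z =
    \sum_(z | B z) F z + \sum_(z | B z && P z) F z.
  by rewrite [X in _ = X + _](bigID P) /= addrAC F2_addrr add0r.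
rewrite (splitB (fun z => z i == 0)) (splitB (fun z => z i == ord_max)).
by rewrite addrACA F2_addrr add0r addrC.
Qed.

(* Stokes: [cup] of [k :: s] is the coboundary of [c k * cup s], so the sum over
   the box reduces to its faces. On the faces in a direction of [s] some factor is
   constant; on those in direction [k] only [z k = ord_max] survives, where [c k = 1]. *)
Lemma cup_total {q N : nat} (c : 'I_q -> {ffun 'I_q -> 'I_N.+2} -> 'F_2) (s : seq 'I_q) :
  (forall i (z : {ffun 'I_q -> 'I_N.+2}), z i = 0 -> c i z = 0) ->
  (forall i (z : {ffun 'I_q -> 'I_N.+2}), z i = ord_max -> c i z = 1) ->
  uniq s ->
  \sum_(z : {ffun 'I_q -> 'I_N.+2} | [forall j, (z j != ord_max) == (j \in s)])
     cup grid_step c s z [set j in s]%SET = 1.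
Proof.
move=> c0 c1; elim: s => [_|k s IH].
  rewrite (big_pred1 [ffun=> ord_max])/=.
    by rewrite (_ : [set j in [::]]%SET = finset.set0) ?eqxx//;
       apply/finset.setP => j; rewrite !inE.
  move=> z; apply/forallP/eqP => [zmax|-> j]; last by rewrite ffunE eqxx.
  by apply/ffunP => j; rewrite ffunE; move: (zmax j); rewrite in_nil eqbF_neg negbK => /eqP.
rewrite cons_uniq => /andP[ks us]; set I := [set j in k :: s]%SET.
under eq_bigr do rewrite (cup_closed_cons _ _ _ (cup_closed _ _ _)) /coboundary.
rewrite exchange_big /=.
(* [B i] drops the condition on coordinate [i], which makes it invariant under translation along
   [i], as telescoping requires. *)
pose B (i : 'I_q) (z : {ffun 'I_q -> 'I_N.+2}) :=
  [forall j, (j != i) ==> ((z j != ord_max) == (j \in k :: s))].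
have boxE i (z : {ffun 'I_q -> 'I_N.+2}) : i \in I ->
    [forall j, (z j != ord_max) == (j \in k :: s)] = B i z && (z i != ord_max).
  rewrite inE => iI; apply/forallP/andP => [zP|[/forallP zP zi] j].
    split; last by rewrite (eqP (zP i)).
    by apply/forallP => j; apply/implyP.
  by have [->|ji] := eqVneq j i; [rewrite iI zi | exact: implyP (zP j) ji].
have Bstep i (z : {ffun 'I_q -> 'I_N.+2}) : B i (z + grid_step i) = B i z.
  apply: eq_forallb => j; have [//|/= ji] := eqVneq j i.
  by rewrite !ffunE (negbTE ji) addr0.
have tele i : i \in I ->
   \sum_(z : {ffun 'I_q -> 'I_N.+2} | [forall j, (z j != ord_max) == (j \in k :: s)])
     (c k (z + grid_step i) * cup grid_step c s (z + grid_step i) (I :\ i) +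
      c k z * cup grid_step c s z (I :\ i)) =
   \sum_(z : {ffun 'I_q -> 'I_N.+2} | B i z && (z i == ord_max))
      c k z * cup grid_step c s z (I :\ i) +
   \sum_(z : {ffun 'I_q -> 'I_N.+2} | B i z && (z i == 0)) c k z * cup grid_step c s z (I :\ i).
  move=> iI; rewrite -(sum_telescope i (B i) (fun z => c k z * cup grid_step c s z (I :\ i))) //.
  by apply: eq_bigl => z; exact: boxE.
rewrite (eq_bigr _ tele) (finset.big_setD1 k) /=; last by rewrite !inE eqxx.
rewrite [X in _ + X]big1 ?addr0; last first.
  move=> i; rewrite !inE => /andP[ik iks].
  have is_ : i \in s by move: iks; rewrite (negbTE ik).
  rewrite !big1 ?addr0// => z /andP[_ /eqP zi].
    rewrite (cup_const _ _ _ i 0) ?mulr0// => J /finset.subsetD1P[_ iJ].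
    by apply: c0; rewrite ffunE sum_grid_stepE (negbTE iJ) zi addr0.
  rewrite (cup_const _ _ _ i 1) ?mulr0// => J /finset.subsetD1P[_ iJ].
  by apply: c1; rewrite ffunE sum_grid_stepE (negbTE iJ) zi addr0.
rewrite [X in _ + X]big1 ?addr0; last first.
  by move=> z /andP[_ /eqP zk]; rewrite c0// mul0r.
rewrite -[RHS](IH us); apply: eq_big => [z|z /andP[_ /eqP zk]].
  apply/andP/forallP => [[/forallP zB /eqP zk] j|zP].
    have [->|jk] := eqVneq j k; first by rewrite zk eqxx (negbTE ks).
    by have := implyP (zB j) jk; rewrite inE (negbTE jk).
  split; last by move: (zP k); rewrite (negbTE ks) eqbF_neg negbK.
  by apply/forallP => j; apply/implyP => jk; rewrite inE (negbTE jk).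
rewrite c1// mul1r; congr (cup _ _ _ _ _); apply/finset.setP => j.
by rewrite !inE; have [->|] := eqVneq j k; rewrite ?(negbTE ks).
Qed.

(** By [cup_total] some cell has a nonzero cup product, and by [cup_const] no [c i] is constant on
    the vertices of that cell. *)
Lemma grid_cell_all_change {q N : nat} (c : 'I_q -> {ffun 'I_q -> 'I_N.+2} -> bool) :
  (forall i (z : {ffun 'I_q -> 'I_N.+2}), z i = 0 -> ~~ c i z) ->
  (forall i (z : {ffun 'I_q -> 'I_N.+2}), z i = ord_max -> c i z) ->
  exists2 z : {ffun 'I_q -> 'I_N.+2}, forall j, z j != ord_max &
    forall i, exists J : {set 'I_q}, c i (z + \sum_(j in J) grid_step j) != c i z.
Proof.
move=> c0 c1; pose cF i (z : {ffun 'I_q -> 'I_N.+2}) : 'F_2 := (c i z)%:R.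
have := cup_total cF (enum 'I_q).
move=> /(_ _ _ (enum_uniq _)) tot.
have {}tot : \sum_(z : {ffun 'I_q -> 'I_N.+2} | [forall j, (z j != ord_max) == (j \in enum 'I_q)])
     cup grid_step cF (enum 'I_q) z [set j in enum 'I_q]%SET != 0.
  rewrite tot ?oner_eq0// => i z zi; rewrite /cF; first by rewrite (negbTE (c0 _ _ zi)).
  by rewrite c1.
have /existsP[z /andP[/forallP zP cz]] : [exists z : {ffun 'I_q -> 'I_N.+2},
    [forall j, (z j != ord_max) == (j \in enum 'I_q)] &&
    (cup grid_step cF (enum 'I_q) z [set j in enum 'I_q]%SET != 0)].
  apply: contraNT tot => /existsPn nz; apply/eqP/big1 => z zP.
  by have := nz z; rewrite zP negbK => /eqP.
exists z => [j|i]; first by rewrite (eqP (zP j)) mem_enum.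
apply: contrapT => nJ; move/negP: cz; apply; apply/eqP.
apply: (cup_const _ _ _ i (cF i z)); first by rewrite mem_enum.
move=> J _; congr (_%:R); apply/eqP; rewrite -[_ == _]negbK; apply/negP => cJ.
by apply: nJ; exists J; apply: contraNneq cJ => ->.
Qed.

(** * Poincare-Miranda theorem *)

Lemma poincare_miranda_approx {R : realType} {q : nat} (phi : 'I_q -> 'rV[R]_q -> R) (N : nat) :
  (forall i (t : 'rV[R]_q), (forall j, 0 <= t 0 j <= 1) -> t 0 i = 0 -> phi i t <= 0) ->
  (forall i (t : 'rV[R]_q), (forall j, 0 <= t 0 j <= 1) -> t 0 i = 1 -> 0 <= phi i t) ->
  exists2 t : 'rV[R]_q, forall j, 0 <= t 0 j <= 1 &
    forall i, exists a b : 'rV[R]_q,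
      [/\ forall j, `|t 0 j - a 0 j| <= N.+1%:R^-1,
          forall j, `|t 0 j - b 0 j| <= N.+1%:R^-1, phi i a <= 0 & 0 <= phi i b].
Proof.
move=> phi0 phi1; pose pt (z : {ffun 'I_q -> 'I_N.+2}) : 'rV[R]_q :=
  \row_j ((z j : nat)%:R / N.+1%:R).
have pt01 (z : {ffun 'I_q -> 'I_N.+2}) j : 0 <= pt z 0 j <= 1.
  rewrite mxE divr_ge0 ?ler0n//= ler_pdivrMr ?ltr0n// mul1r ler_nat.
  by rewrite -ltnS ltn_ord.
(* The first disjunct fixes the value on the upper face, where [phi i] may vanish; both classes
   still determine a weak sign of [phi i]. *)
pose c i (z : {ffun 'I_q -> 'I_N.+2}) := (z i == ord_max) || (0 < phi i (pt z)).
have cle i (z : {ffun 'I_q -> 'I_N.+2}) : ~~ c i z -> phi i (pt z) <= 0.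
  by rewrite negb_or -leNgt => /andP[].
have cge i (z : {ffun 'I_q -> 'I_N.+2}) : c i z -> 0 <= phi i (pt z).
  case/orP => [/eqP zi|/ltW//]; apply: phi1 => //.
  by rewrite mxE zi divff// pnatr_eq0.
have [|//|z zmax zJ] := grid_cell_all_change c.
- move=> i z zi; rewrite negb_or zi -leNgt; apply/andP; split=> //.
  by apply: phi0 => //; rewrite mxE zi mul0r.
- by move=> i z zi; rewrite /c zi eqxx.
exists (pt z) => // i; have [J cJ] := zJ i.
set y := z + \sum_(j in J) grid_step j in cJ.
have near0 j : `|pt z 0 j - pt z 0 j| <= N.+1%:R^-1 by rewrite subrr normr0.
have near1 j : `|pt z 0 j - pt y 0 j| <= N.+1%:R^-1.
  (* The base vertex avoids the last layer, so a step does not wrap around and moves each coordinate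
     by at most one mesh width. *)
  have zN : (z j < N.+1)%N.
    by rewrite ltn_neqAle -ltnS ltn_ord andbT; apply: contra (zmax j) => /eqP zj; apply/eqP/val_inj.
  have yj : (y j : nat) = (z j + (j \in J))%N.
    rewrite /y ffunE sum_grid_stepE; case: (j \in J) => /=.
      by rewrite !modn_small ?addn1//.
    by rewrite !addn0 modn_small ?ltn_ord.
  rewrite !mxE yj -mulrBl natrD opprD addrA subrr sub0r mulNr normrN.
  rewrite ger0_norm ?divr_ge0 ?ler0n// ler_piMl ?invr_ge0 ?ler0n//.
  by rewrite lern1 leq_b1.
case cz: (c i z) cJ; rewrite ?eqbF_neg ?eqb_id ?negbK => cy.
- by exists (pt y), (pt z); split=> //; [apply: cle; case: (c i y) cy | apply: cge].
- by exists (pt z), (pt y); split=> //; [apply: cle; rewrite cz | apply: cge; case: (c i y) cy].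
Qed.

(** Every ball around a cluster point of the approximate solutions contains points with both weak
    signs of [phi i], so continuity rules out a nonzero value there. *)
Lemma poincare_miranda {R : realType} {q : nat} (phi : 'I_q -> 'rV[R]_q -> R) :
  (forall i, continuous (phi i)) ->
  (forall i (t : 'rV[R]_q), (forall j, 0 <= t 0 j <= 1) -> t 0 i = 0 -> phi i t <= 0) ->
  (forall i (t : 'rV[R]_q), (forall j, 0 <= t 0 j <= 1) -> t 0 i = 1 -> 0 <= phi i t) ->
  exists2 t : 'rV[R]_q, forall j, 0 <= t 0 j <= 1 & forall i, phi i t = 0.
Proof.
move=> phic phi0 phi1.
have /choice[u uP] : forall N, exists t : 'rV[R]_q, (forall j, 0 <= t 0 j <= 1) /\
    forall i, exists a b : 'rV[R]_q,
      [/\ forall j, `|t 0 j - a 0 j| <= N.+1%:R^-1,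
          forall j, `|t 0 j - b 0 j| <= N.+1%:R^-1, phi i a <= 0 & 0 <= phi i b].
  move=> N; have [t t01 tN] := poincare_miranda_approx phi N phi0 phi1.
  by exists t.
have cubeK : compact [set t : 'rV[R]_q | forall j, `[0, 1]%classic (t 0 j)].
  exact: (@rV_compact R q (fun=> `[0, 1]%classic) (fun=> @segment_compact R 0 1)).
have [|t [tK tcl]] := cubeK (u @ \oo)%classic _.
  by exists 0%N => // N _ j /=; rewrite in_itv /=; exact: (uP N).1.
have cell i (e : R) : 0 < e -> exists a b : 'rV[R]_q,
    [/\ ball t e a, ball t e b, phi i a <= 0 & 0 <= phi i b].
  (* Half of the radius covers the distance to the cluster point, the other half the mesh width. *)
  move=> e0; have e20 : 0 < e / 2 by rewrite divr_gt0.
  have smallN : (\forall N \near \oo, N.+1%:R^-1 < e / 2 :> R)%classic.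
    exact: near_infty_natSinv_lt (PosNum e20).
  have uoo : ((u @ \oo) [set u N | N in [set N | N.+1%:R^-1 < e / 2 :> R]])%classic.
    by apply: filterS smallN => N /= Ne; exists N.
  have [_ [[N /= Ne <-] tu]] := tcl _ _ uoo (nbhsx_ballx t _ e20).
  have [a [b [ta tb pa pb]]] := (uP N).2 i.
  have in_ball (y : 'rV[R]_q) : (forall j, `|u N 0 j - y 0 j| <= N.+1%:R^-1) -> ball t e y.
    move=> uy; rewrite (splitr e); apply: ball_triangle tu _; split=> // k j.
    by rewrite /ball /= (ord1 k) (le_lt_trans (uy j)).
  by exists a, b; split=> //; exact: in_ball.
exists t => [j|i]; first by have := tK j; rewrite /= in_itv.
apply/eqP; case: (ltgtP (phi i t) 0) => // ht; exfalso.
  have /nbhs_ballP[e /= e0 eP] : \forall y \near t, phi i y < 0.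
    exact: (@cvgr_lt R _ _ (nbhs_filter t) (phi i) _ (phic i t)).
  have [_ [b [_ tb _ pb]]] := cell i e e0.
  by have := eP b tb; rewrite /= ltNge pb.
have /nbhs_ballP[e /= e0 eP] : \forall y \near t, 0 < phi i y.
  exact: (@cvgr_gt R _ _ (nbhs_filter t) (phi i) _ (phic i t)).
have [a [_ [ta _ pa _]]] := cell i e e0.
by have := eP a ta; rewrite /= ltNge pa.
Unshelve. all: end_near.
Qed.

(** * Farkas' lemma *)

Lemma dotDl {R : realType} {n : nat} (u v w : 'rV[R]_n) : dot (u + v) w = dot u w + dot v w.
Proof. by rewrite /dot mulmxDl mxE. Qed.

Lemma dotZl {R : realType} {n : nat} a (u w : 'rV[R]_n) : dot (a *: u) w = a * dot u w.
Proof. by rewrite /dot -scalemxAl mxE. Qed.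

Lemma dotNl {R : realType} {n : nat} (u w : 'rV[R]_n) : dot (- u) w = - dot u w.
Proof. by rewrite -scaleN1r dotZl mulN1r. Qed.

Lemma dotC {R : realType} {n : nat} (u w : 'rV[R]_n) : dot u w = dot w u.
Proof. by rewrite /dot !mxE; apply: eq_bigr => j _; rewrite !mxE mulrC. Qed.

Lemma dotBr {R : realType} {n : nat} a (u v w : 'rV[R]_n) :
  dot u (v - a *: w) = dot u v - a * dot u w.
Proof. by rewrite dotC dotDl dotNl dotZl !(dotC u). Qed.

Lemma dot_suml {R : realType} {n : nat} {I : Type} (r : seq I) (F : I -> 'rV[R]_n) w :
  dot (\sum_(i <- r) F i) w = \sum_(i <- r) dot (F i) w.
Proof. by rewrite /dot mulmx_suml summxE. Qed.

(* Bartl's induction: if the last constraint matters, some [v0] satisfies the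
   others, violates the conclusion, and is normalised by [dot (a k) v0 = 1];
   projecting along [v0] eliminates the constraint [k]. *)
Lemma farkas_seq {R : realType} {n : nat} {I : eqType} (s : seq I)
    (a : I -> 'rV[R]_n) (c : 'rV[R]_n) :
  uniq s ->
  (forall v, (forall i, i \in s -> dot (a i) v <= 0) -> dot c v <= 0) ->
  exists2 y : I -> R, forall i, 0 <= y i & c = \sum_(i <- s) y i *: a i.
Proof.
elim: s a c => [|k s IH] a c /=.
  move=> _ cP; exists (fun=> 0) => //; rewrite big_nil.
  (* With no constraints, [c] itself is an admissible test vector. *)
  have cc : dot c c <= 0 by exact: cP.
  apply/rowP => j; rewrite mxE; apply/eqP; rewrite -sqrf_eq0 eq_le sqr_ge0 andbT.
  apply: le_trans cc; rewrite /dot mxE (bigD1 j)//= mxE expr2 lerDl.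
  by apply: sumr_ge0 => i _; rewrite mxE -expr2 sqr_ge0.
case/andP=> ks us cP.
have [sP|] := pselect (forall v, (forall i, i \in s -> dot (a i) v <= 0) -> dot c v <= 0).
  have [y y0 yc] := IH a c us sP; exists (fun i => if i == k then 0 else y i).
    by move=> i; case: ifP.
  rewrite big_cons eqxx scale0r add0r yc; apply: eq_big_seq => i si.
  by case: eqP => // ik; rewrite -ik si in ks.
move=> /existsNP[w /not_implyP[wP /negP]]; rewrite -ltNge => cw.
have akw : 0 < dot (a k) w.
  rewrite ltNge; apply/negP => akw; move: cw; rewrite ltNge => /negP; apply.
  by apply: cP => i; rewrite inE => /predU1P[->//|/wP].
pose v0 := (dot (a k) w)^-1 *: w.
have dot_v0 b : dot b v0 = (dot (a k) w)^-1 * dot b w by rewrite dotC dotZl (dotC w).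
have akv0 : dot (a k) v0 = 1 by rewrite dot_v0 mulVf// gt_eqF.
have proj b v : dot (b - dot b v0 *: a k) v = dot b (v - dot (a k) v *: v0).
  by rewrite dotBr dotDl dotNl dotZl mulrC.
have [v v_s|y y0 yc] := IH (fun i => a i - dot (a i) v0 *: a k) (c - dot c v0 *: a k) us.
  rewrite proj; apply: cP => i; rewrite inE => /predU1P[->|/v_s].
    by rewrite dotBr akv0 mulr1 subrr.
  by rewrite proj.
(* The coefficient of [a k] left over when the projections along [v0] are undone. It is nonnegative
   because [v0] violates the conclusion and satisfies the constraints in [s]. *)
pose yk := dot c v0 - \sum_(i <- s) y i * dot (a i) v0.
have yk0 : 0 <= yk.
  rewrite subr_ge0; apply: (@le_trans _ _ 0).
    rewrite big_seq; apply: sumr_le0 => i si; rewrite mulr_ge0_le0// dot_v0.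
    by rewrite mulr_ge0_le0 ?wP// invr_ge0 ltW.
  by rewrite dot_v0 mulr_ge0 ?invr_ge0 ?ltW.
exists (fun i => if i == k then yk else y i); first by move=> i; case: ifP.
rewrite big_cons eqxx /yk scalerBl scaler_suml.
rewrite -[c in LHS](subrK (dot c v0 *: a k)) yc addrC -addrA; congr (_ + _).
rewrite addrC -sumrB; apply: eq_big_seq => i si.
case: eqP => [ik|_]; first by rewrite -ik si in ks.
by rewrite scalerBr scalerA.
Qed.

(* The two flags say which of [dot (a i) v <= 0], [0 <= dot (a i) v] is imposed:
   both give an equation, neither no constraint. *)
Lemma farkas {R : realType} {n : nat} {I : finType} (le ge : pred I)
    (a : I -> 'rV[R]_n) (c : 'rV[R]_n) :
  (forall v, (forall i, le i -> dot (a i) v <= 0) ->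
     (forall i, ge i -> 0 <= dot (a i) v) -> dot c v <= 0) ->
  exists2 y : I -> R, c = \sum_i y i *: a i &
    forall i, (~~ ge i -> 0 <= y i) /\ (~~ le i -> y i <= 0).
Proof.
(* The pair [(i, true)] stands for the vector [a i] and [(i, false)] for [- a i]; the final
   multiplier is the difference of theirs. *)
move=> cP; pose P (x : I * bool) := if x.2 then le x.1 else ge x.1.
have [||y y0 yc] := farkas_seq [seq x <- enum {: I * bool} | P x]
  (fun x => if x.2 then a x.1 else - a x.1) c.
- exact/filter_uniq/enum_uniq.
- move=> v vP; apply: cP => i Pi.
    by have /= := vP (i, true); apply; rewrite mem_filter /P /= Pi mem_enum.
  have /= := vP (i, false); rewrite mem_filter /P /= Pi mem_enum dotNl oppr_le0; exact.
exists (fun i => (if le i then y (i, true) else 0) - (if ge i then y (i, false) else 0)).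
  rewrite yc big_filter big_enum_cond big_mkcond.
  rewrite (eq_bigr (fun x => (fun i b => if P (i, b) then
    y (i, b) *: (if b then a i else - a i) else 0) x.1 x.2)); last by case.
  rewrite -(pair_bigA _ (fun i b => if P (i, b) then
    y (i, b) *: (if b then a i else - a i) else 0)) /=.
  apply: eq_bigr => i _; rewrite big_bool /P /= scalerBl scalerN.
  by case: (le i); case: (ge i); rewrite ?scale0r ?oppr0.
move=> i; split=> /negbTE ->; first by rewrite subr0; case: ifP.
by rewrite sub0r oppr_le0; case: ifP.
Qed.

(** * Multilinear interpolation on the cube *)

(** For [t] in the cube, this is the probability of [alpha] when its bits are independent and bit
    [i] is true with probability [t 0 i]. *)
Definition multilinear_weight {R : realType} {p : nat} (t : 'rV[R]_p)
    (alpha : {ffun 'I_p -> bool}) : R :=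
  \prod_i (if alpha i then t 0 i else 1 - t 0 i).

Lemma multilinear_weight_ge0 {R : realType} {p : nat} (t : 'rV[R]_p) alpha :
  (forall j, 0 <= t 0 j <= 1) -> 0 <= multilinear_weight t alpha.
Proof.
move=> t01; apply: prodr_ge0 => i _; have /andP[t0 t1] := t01 i.
by case: ifP; rewrite ?subr_ge0.
Qed.

Lemma sum_multilinear_weight {R : realType} {p : nat} (t : 'rV[R]_p) :
  \sum_alpha multilinear_weight t alpha = 1.
Proof.
rewrite /multilinear_weight.
rewrite -(bigA_distr_bigA (fun i (b : bool) => if b then t 0 i else 1 - t 0 i)).
by apply: big1 => i _; rewrite big_bool /= addrC subrK.
Qed.

(** Only the vertices on a facet carry weight there, which turns conditions at vertices into
    boundary conditions. *)
Lemma multilinear_weight_face {R : realType} {p : nat} (t : 'rV[R]_p)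
    (alpha : {ffun 'I_p -> bool}) i :
  t 0 i = (~~ alpha i)%:R -> multilinear_weight t alpha = 0.
Proof.
move=> ti; rewrite /multilinear_weight (bigD1 i)//= ti.
by case: (alpha i); rewrite ?subrr mul0r.
Qed.

Lemma continuous_multilinear_weight {R : realType} {p : nat} alpha :
  continuous (fun t : 'rV[R]_p => multilinear_weight t alpha).
Proof.
apply: (continuous_big (@mul_continuous R)) => i _ t.
case: (alpha i); first exact: coord_continuous.
apply: (@continuousB R R^o _ (fun=> 1) (fun t : 'rV[R]_p => t 0 i) t).
  exact: cst_continuous.
exact: coord_continuous.
Qed.

Lemma exists_complementary_combination {R : realType} {p : nat} (J : {set 'I_p})
    (d : 'rV[R]_p) (mu nu : {ffun 'I_p -> bool} -> 'rV[R]_p) :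
  (forall i, 0 <= d 0 i <= 1) ->
  (forall alpha i, i \in J -> 0 <= mu alpha 0 i) ->
  (forall (alpha : {ffun 'I_p -> bool}) i, i \in J -> ~~ alpha i -> mu alpha 0 i = 0) ->
  (forall (alpha : {ffun 'I_p -> bool}) i, i \in J -> alpha i -> 0 <= nu alpha 0 i) ->
  exists w : {ffun 'I_p -> bool} -> R,
    [/\ forall alpha, 0 <= w alpha, \sum_alpha w alpha = 1 &
      forall i, i \in J ->
        let M := \sum_alpha w alpha * mu alpha 0 i in
        let N := \sum_alpha w alpha * nu alpha 0 i in
        (M = 0 /\ 0 <= N) \/ (1 - d 0 i) * M = - d 0 i * N].
Proof.
move=> d01 mu0 muF nuT.
pose M i t := \sum_alpha multilinear_weight t alpha * mu alpha 0 i.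
pose N i t := \sum_alpha multilinear_weight t alpha * nu alpha 0 i.
(* [phi i] vanishes only at complementary pairs, is at most 0 when [mu i = 0]
   and nonnegative on the quadrant [mu i, nu i >= 0]. *)
pose phi i (t : 'rV[R]_p) := if i \in J
  then Num.min (M i t) (d 0 i * N i t + (1 - d 0 i) * M i t) else t 0 i - 2^-1.
have comb_cont (z : {ffun 'I_p -> bool} -> R) :
    continuous (fun t => \sum_alpha multilinear_weight t alpha * z alpha).
  apply: (@continuous_big R _ +%R 0 xpredT (@add_continuous R^o)) => alpha _ t.
  apply: (@continuousM _ _ (fun t => multilinear_weight t alpha) (fun=> z alpha)).
    exact: continuous_multilinear_weight.
  exact: cst_continuous.
have [|||t t01 tphi] := poincare_miranda phi.
- move=> i t; rewrite /phi; case: (i \in J); last first.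
    apply: (@continuousB R R^o _ (fun t : 'rV[R]_p => t 0 i) (fun=> 2^-1) t).
      exact: coord_continuous.
    exact: cst_continuous.
  apply: (@continuous_min R _ (M i) (fun t => d 0 i * N i t + (1 - d 0 i) * M i t) t).
    exact: comb_cont.
  apply: (@continuousD R R^o _ (fun t => d 0 i * N i t) (fun t => (1 - d 0 i) * M i t) t).
    apply: (@continuousM _ _ (fun=> d 0 i) (N i)); [exact: cst_continuous | exact: comb_cont].
  apply: (@continuousM _ _ (fun=> 1 - d 0 i) (M i)); [exact: cst_continuous | exact: comb_cont].
(* For [i] outside [J], the placeholder [t 0 i - 2^-1] has the required sign on both facets. *)
- move=> i t t01 ti; rewrite /phi; case: ifP => iJ; last first.
    by rewrite ti sub0r oppr_le0 invr_ge0.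
  have -> : M i t = 0.
    apply: big1 => alpha _; case: (boolP (alpha i)) => ai; last by rewrite muF ?mulr0.
    by rewrite (multilinear_weight_face _ _ i) ?mul0r// ai.
  by rewrite ge_min lexx.
- move=> i t t01 ti; rewrite /phi; case: ifP => iJ; last first.
    by rewrite ti subr_ge0 invf_le1 ?ler1n.
  have /andP[d0 d1] := d01 i.
  have w0 := multilinear_weight_ge0 t.
  have M0 : 0 <= M i t by apply: sumr_ge0 => alpha _; rewrite mulr_ge0 ?mu0// w0.
  have N0 : 0 <= N i t.
    apply: sumr_ge0 => alpha _; case: (boolP (alpha i)) => ai.
      by rewrite mulr_ge0 ?nuT// w0.
    by rewrite (multilinear_weight_face _ _ i) ?mul0r// ai.
  by rewrite le_min M0 addr_ge0 ?mulr_ge0// subr_ge0.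
- exists (multilinear_weight t); split=> [alpha||i iJ /=].
  + exact: multilinear_weight_ge0.
  + exact: sum_multilinear_weight.
  have /andP[d0 d1] := d01 i.
  rewrite -/(M i t) -/(N i t); have := tphi i; rewrite /phi iJ.
  case: (leP (M i t) (_ + _)) => [le0 M0|_ lin0]; last first.
    by right; apply/eqP; rewrite mulNr -subr_eq0 opprK addrC lin0.
  rewrite M0 mulr0 addr0 in le0 *.
  (* Here [M i t = 0] and [d 0 i * N i t] is nonnegative. This gives the sign of [N i t] unless
     [d 0 i = 0], where the linear equation is trivial. *)
  have [di0|di_neq0] := eqVneq (d 0 i) 0; first by right; rewrite di0 oppr0 mul0r.
  by left; split=> //; move: le0; rewrite pmulr_rge0// lt0r di_neq0.
Qed.

(** * Convexity of the multiplier set and the four implications *)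

Lemma scaler_sum_comb {R : realType} {n k : nat} {A : finType} (w : A -> R)
    (u : A -> 'rV[R]_k) (a : 'I_k -> 'rV[R]_n) :
  \sum_i (\sum_alpha w alpha *: u alpha) 0 i *: a i =
  \sum_alpha w alpha *: \sum_i u alpha 0 i *: a i.
Proof.
under [RHS]eq_bigr do rewrite scaler_sumr.
rewrite exchange_big; apply: eq_bigr => i _; rewrite summxE scaler_suml.
by apply: eq_bigr => alpha _; rewrite mxE scalerA.
Qed.

Lemma comb_entry {R : realType} {k : nat} {A : finType} (w : A -> R)
    (u : A -> 'rV[R]_k) i :
  (\sum_alpha w alpha *: u alpha) 0 i = \sum_alpha w alpha * u alpha 0 i.
Proof. by rewrite summxE; apply: eq_bigr => alpha _; rewrite mxE. Qed.

(** The conditions are linear equations and sign conditions at a fixed point; total weight 1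
    reproduces the inhomogeneous term, the gradient of the objective. *)
Lemma weak_system_comb {R : realType} {n l m p : nat} {P : mpvc R n l m p} {x}
    {A : finType} (w : A -> R) lambda eta mu nu :
  (forall alpha, 0 <= w alpha) -> \sum_alpha w alpha = 1 ->
  (forall alpha, weak_system P x (lambda alpha) (eta alpha) (mu alpha) (nu alpha)) ->
  weak_system P x (\sum_alpha w alpha *: lambda alpha) (\sum_alpha w alpha *: eta alpha)
    (\sum_alpha w alpha *: mu alpha) (\sum_alpha w alpha *: nu alpha).
Proof.
move=> w0 w1 ws.
have ge0 k (u : A -> 'rV[R]_k) i : (forall alpha, 0 <= u alpha 0 i) ->
    0 <= (\sum_alpha w alpha *: u alpha) 0 i.
  by move=> u0; rewrite comb_entry; apply: sumr_ge0 => alpha _; rewrite mulr_ge0.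
have eq0 k (u : A -> 'rV[R]_k) i : (forall alpha, u alpha 0 i = 0) ->
    (\sum_alpha w alpha *: u alpha) 0 i = 0.
  by move=> u0; rewrite comb_entry; apply: big1 => alpha _; rewrite u0 mulr0.
split.
  rewrite !scaler_sum_comb -[gradient _ x]scale1r -w1 scaler_suml -!big_split /= -sumrB.
  apply: big1 => alpha _; have [E _] := ws alpha.
  by rewrite -!scalerDr -scalerBr E scaler0.
split; [split | split] => i iP.
- by apply: ge0 => alpha; have [_ [[+ _ _ _] _]] := ws alpha; exact.
- by apply: eq0 => alpha; have [_ [[_ + _ _] _]] := ws alpha; exact.
- by apply: eq0 => alpha; have [_ [[_ _ + _] _]] := ws alpha; exact.
- by apply: ge0 => alpha; have [_ [[_ _ _ +] _]] := ws alpha; exact.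
- by apply: eq0 => alpha; have [_ [_ [+ _]]] := ws alpha; exact.
- by apply: ge0 => alpha; have [_ [_ [_ +]]] := ws alpha; exact.
Qed.

Lemma A_stationary_Pd {R : realType} {n l m p : nat} {P : mpvc R n l m p} {x} :
  (forall alpha, A_stationary P alpha x) ->
  forall d : 'rV[R]_p, (forall i, 0 <= d 0 i <= 1) -> Pd_stationary P d x.
Proof.
move=> Ax d d01; have [Px _] := Ax [ffun=> true]; split=> //.
have /choice[lambda /choice[eta /choice[mu /choice[nu z]]]] := fun alpha => (Ax alpha).2.
have [||||w [w0 w1 wz]] := exists_complementary_combination (I00 P x) d mu nu.
- exact: d01.
- by move=> alpha i iJ; have [[_ [[_ _ _ mu0] _]] _ _] := z alpha; rewrite mu0// inE iJ orbT.
- by move=> alpha i iJ ai; have [_ muF _] := z alpha; rewrite muF// inE iJ (negbTE ai).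
- by move=> alpha i iJ ai; have [_ _ nuT] := z alpha; rewrite nuT// inE iJ ai.
exists (\sum_alpha w alpha *: lambda alpha), (\sum_alpha w alpha *: eta alpha),
  (\sum_alpha w alpha *: mu alpha), (\sum_alpha w alpha *: nu alpha); split.
  by apply: weak_system_comb => // alpha; have [] := z alpha.
by move=> i iJ; rewrite !comb_entry; exact: wz.
Qed.

(** Take for [d] the vertex [alpha] of the cube: the linear equation becomes [mu 0 i = 0] where
    [d 0 i = 0] and [nu 0 i = 0] where [d 0 i = 1]. *)
Lemma Pd_stationary_P {R : realType} {n l m p : nat} {P : mpvc R n l m p} {x} :
  (forall d : 'rV[R]_p, (forall i, 0 <= d 0 i <= 1) -> Pd_stationary P d x) ->
  forall alpha, P_stationary P alpha x.
Proof.
move=> Pdx alpha.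
have [|Px [lambda [eta [mu [nu [ws dz]]]]]] := Pdx (\row_i (alpha i)%:R).
  by move=> i; rewrite mxE; case: (alpha i); rewrite ?lexx ler01.
split=> //; exists lambda, eta, mu, nu; split=> // i; rewrite inE => /andP[iJ /eqP ai].
- by have := dz i iJ; rewrite mxE ai subr0 mul1r oppr0 mul0r => -[[]|].
- have := dz i iJ; rewrite mxE ai subrr mul0r mulN1r => -[|nuN0]; [by left|right].
  by rewrite -[LHS]opprK -nuN0 oppr0.
Qed.

Lemma P_stationary_linB {R : realType} {n l m p : nat} {P : mpvc R n l m p} {x} :
  (forall alpha, P_stationary P alpha x) -> linB_stationary P x.
Proof.
move=> PAx; split; first by have [] := PAx [ffun=> true].
move=> v [[gv hv G0p] [Hp0 H0 GH]].
(* The vertex is adapted to the direction [v], so that the multipliers for this [alpha] make every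
   index contribute a nonpositive amount. *)
pose alpha := [ffun i => dot (gradient (component (mpvc_G P) i) x) v <= 0].
have [Px [lambda [eta [mu [nu [[E [[la0 laC muC mu0] [nuC nu0]]] aF aT]]]]]] := PAx alpha.
set gf := gradient _ _ in E *.
have -> : - gf = \sum_i lambda 0 i *: gradient (component (mpvc_g P) i) x
    + \sum_i eta 0 i *: gradient (component (mpvc_h P) i) x
    + \sum_i mu 0 i *: gradient (component (mpvc_G P) i) x
    - \sum_i nu 0 i *: gradient (component (mpvc_H P) i) x.
  by apply/esym/subr0_eq; rewrite opprK addrC !addrA.
rewrite !dotDl dotNl !dot_suml.
rewrite [X in _ + X + _ + _]big1 ?addr0; last by move=> i _; rewrite dotZl hv mulr0.
rewrite -addrA -sumrB -[leRHS]addr0.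
apply: lerD; apply: sumr_le0 => i _; rewrite !dotZl.
  have [iP|iP] := boolP (i \in Ig P x); first by rewrite mulr_ge0_le0 ?la0 ?gv.
  by rewrite laC ?mul0r// inE.
have [_ _ FH FGH] := Px.
have [iP|iP] := boolP (i \in I00 P x).
  have Hge : 0 <= dot (gradient (component (mpvc_H P) i) x) v by apply: H0; rewrite inE iP.
  have muge : 0 <= mu 0 i by apply: mu0; rewrite inE iP orbT.
  have [Gle|Ggt] := leP (dot (gradient (component (mpvc_G P) i) x) v) 0.
    have iT : i \in I00_eq P x alpha true by rewrite inE iP ffunE Gle.
    rewrite subr_le0; apply: (@le_trans _ _ 0); first by rewrite mulr_ge0_le0.
    by have [[_ nuge]|->] := aT i iT; [exact: mulr_ge0 | rewrite mul0r].
  have iF : i \in I00_eq P x alpha false by rewrite inE iP ffunE leNgt Ggt.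
  rewrite (aF i iF) mul0r sub0r oppr_le0.
  (* As the [G] factor is positive, the product condition forces the [H] factor to vanish, whatever
     the sign of [nu 0 i]. *)
  have := GH i iP; rewrite pmulr_rle0// => Hle.
  by rewrite (@le_anti _ _ _ 0 (introT andP (conj Hle Hge))) mulr0.
have := FH i; rewrite le_eqVlt eq_sym => /orP[/eqP Hi0|Hi].
  have [Gi|Gi|Gi] := ltgtP (component (mpvc_G P) i x) 0.
  - have iM : i \in Im0 P x by rewrite inE Gi Hi0 eqxx.
    rewrite muC ?inE ?Gi ?Hi0 ?eqxx ?orbT// mul0r sub0r oppr_le0.
    by rewrite mulr_ge0 ?nu0// H0// inE iM orbT.
  - have iM : i \in Ip0 P x by rewrite inE Gi Hi0 eqxx.
    by rewrite Hp0// muC ?inE ?Gi ?Hi0 ?eqxx// mul0r mulr0 subr0.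
  - by move: iP; rewrite inE Gi Hi0 !eqxx.
have [Gi|Gi|Gi] := ltgtP (component (mpvc_G P) i x) 0.
- rewrite muC; last by rewrite !inE Gi Hi !orbT.
  by rewrite nuC ?inE ?Gi ?Hi ?orbT// !mul0r subr0.
- by have := FGH i; rewrite leNgt mulr_gt0.
- have iM : i \in I0p P x by rewrite inE Gi Hi eqxx.
  rewrite nuC ?inE -?topredE /= ?Gi ?Hi ?eqxx// mul0r subr0.
  by rewrite mulr_ge0_le0 ?G0p// mu0// inE iM.
Qed.

(** Farkas' lemma is applied to a polyhedral subcone: on [I00], a true bit of [alpha] imposes the
    [G] and [H] inequalities, a false bit leaves [G] free and makes [H] an equation. A free [G]
    yields [mu 0 i = 0]. *)
Lemma linB_A_stationary {R : realType} {n l m p : nat} {P : mpvc R n l m p} {x} :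
  linB_stationary P x -> forall alpha, A_stationary P alpha x.
Proof.
move=> [Px polarx] alpha; split=> //.
pose a (k : 'I_l + 'I_m + ('I_p + 'I_p)) := match k with
  | inl (inl i) => gradient (component (mpvc_g P) i) x
  | inl (inr i) => gradient (component (mpvc_h P) i) x
  | inr (inl i) => gradient (component (mpvc_G P) i) x
  | inr (inr i) => gradient (component (mpvc_H P) i) x end.
pose le (k : 'I_l + 'I_m + ('I_p + 'I_p)) := match k with
  | inl (inl i) => i \in Ig P x
  | inl (inr i) => true
  | inr (inl i) => (i \in I0p P x) || (i \in I00_eq P x alpha true)
  | inr (inr i) => (i \in Ip0 P x) || (i \in I00_eq P x alpha false) end.
pose ge (k : 'I_l + 'I_m + ('I_p + 'I_p)) := match k with
  | inl (inl i) => false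
  | inl (inr i) => true
  | inr (inl i) => false
  | inr (inr i) => [|| i \in Ip0 P x, i \in I00 P x | i \in Im0 P x] end.
have [v vle vge|y yc ysgn] := farkas le ge a (- gradient (mpvc_f P) x).
  have eq0 k : le k -> ge k -> dot (a k) v = 0.
    by move=> kl kg; apply: le_anti; rewrite vle// vge.
  have I00P i : i \in I00 P x -> (i \in I00_eq P x alpha true) = alpha i.
    by move=> iJ; rewrite inE iJ; case: (alpha i).
  have I00P' i : i \in I00 P x -> (i \in I00_eq P x alpha false) = ~~ alpha i.
    by move=> iJ; rewrite inE iJ; case: (alpha i).
  apply: polarx; split; split=> [i iP|i|i iP].
  - exact: vle (inl (inl i)) iP.
  - exact: eq0 (inl (inr i)) isT isT.
  - by apply: vle (inr (inl i)) _; rewrite /= iP.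
  - by apply: eq0 (inr (inr i)) _ _; rewrite /= iP.
  - by rewrite inE => iP; apply: vge (inr (inr i)) _; rewrite /= iP orbT.
  - have Hge : 0 <= dot (gradient (component (mpvc_H P) i) x) v.
      by apply: vge (inr (inr i)) _; rewrite /= iP orbT.
    case: (boolP (alpha i)) => ai.
      by rewrite mulr_le0_ge0//; apply: vle (inr (inl i)) _; rewrite /= I00P// ai orbT.
    suff -> : dot (gradient (component (mpvc_H P) i) x) v = 0 by rewrite mulr0.
    by apply: eq0 (inr (inr i)) _ _; rewrite /= ?I00P' ?iP ?ai ?orbT.
(* The last block changes sign because the [H] gradients enter the stationarity equation with a
   minus. *)
exists (\row_i y (inl (inl i))), (\row_i y (inl (inr i))),
  (\row_i y (inr (inl i))), (\row_i - y (inr (inr i))).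
have ge0 k : ~~ ge k -> 0 <= y k by case: (ysgn k).
have le0 k : ~~ le k -> y k <= 0 by case: (ysgn k).
have yeq0 k : ~~ le k -> ~~ ge k -> y k = 0.
  by move=> kl kg; apply: le_anti; rewrite le0// ge0.
have row_sum k (z : 'I_k -> R) (b : 'I_k -> 'rV[R]_n) :
    \sum_i (\row_j z j) 0 i *: b i = \sum_i z i *: b i.
  by apply: eq_bigr => i _; rewrite mxE.
split.
- split.
    rewrite !row_sum -!addrA -sumrN; under [X in _ + (_ + (_ + (_ + X)))]eq_bigr do
      rewrite scaleNr opprK.
    apply/eqP; rewrite addrC addr_eq0; apply/eqP.
    by rewrite yc !big_sumType /= -!addrA.
  split; [split | split] => i; rewrite ?mxE.
  + by move=> _; exact: ge0 (inl (inl i)) isT.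
  + by rewrite inE => iP; exact: yeq0 (inl (inl i)) iP isT.
  + move=> iP; apply: yeq0 (inr (inl i)) _ isT; move: iP; rewrite /= !inE.
    by case: (ltgtP (component (mpvc_G P) i x) 0); case: (ltgtP (component (mpvc_H P) i x) 0).
  + by move=> _; exact: ge0 (inr (inl i)) isT.
  + move=> iP; rewrite yeq0 ?oppr0//; move: iP; rewrite /= !inE;
      by case: (ltgtP (component (mpvc_G P) i x) 0); case: (ltgtP (component (mpvc_H P) i x) 0).
  + move=> iP; rewrite oppr_ge0; apply: le0; move: iP; rewrite /= !inE.
    by case: (ltgtP (component (mpvc_G P) i x) 0); case: (ltgtP (component (mpvc_H P) i x) 0).
- move=> i iP; rewrite mxE; apply: yeq0 (inr (inl i)) _ isT; move: iP; rewrite /= !inE.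
  by case: (alpha i); rewrite ?andbF//;
    case: (ltgtP (component (mpvc_G P) i x) 0); case: (ltgtP (component (mpvc_H P) i x) 0).
- move=> i iP; rewrite mxE oppr_ge0; apply: le0; move: iP; rewrite /= !inE.
  by case: (alpha i); rewrite ?andbF//;
    case: (ltgtP (component (mpvc_G P) i x) 0); case: (ltgtP (component (mpvc_H P) i x) 0).
Qed.

Theorem corollary6p3 (R : realType) (n l m p : nat)
  (f : 'rV[R]_n -> R) (g : 'rV[R]_n -> 'rV[R]_l) (h : 'rV[R]_n -> 'rV[R]_m)
  (G H : 'rV[R]_n -> 'rV[R]_p)
  (df : forall y : 'rV[R]_n, differentiable f y) (dg : forall y : 'rV[R]_n, differentiable g y)
  (dh : forall y : 'rV[R]_n, differentiable h y) (dG : forall y : 'rV[R]_n, differentiable G y)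
  (dH : forall y : 'rV[R]_n, differentiable H y) (x : 'rV[R]_n)
  (hx : feasible (Mpvc f g h G H) x) :
  [<-> linB_stationary (Mpvc f g h G H) x;
       forall alpha : {ffun 'I_p -> bool},
         A_stationary (Mpvc f g h G H) alpha x;
       forall d : 'rV[R]_p, (forall i, 0 <= d 0 i <= 1) ->
         Pd_stationary (Mpvc f g h G H) d x;
       forall alpha : {ffun 'I_p -> bool},
         P_stationary (Mpvc f g h G H) alpha x].
Proof.
tfae.
- exact: linB_A_stationary.
- exact: A_stationary_Pd.
- exact: Pd_stationary_P.
- exact: P_stationary_linB.
Qed.
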